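(* Let $\mathcal H$ be a separable infinite-dimensional Hilbert space, $G$ a positive semidefinite unbounded densely defined self-adjoint operator on $\mathcal H$ with $\inf\{\|G\varphi\| : \varphi\in\mathcal D(G),\|\varphi\|=1\}=0$, and $\mathcal K$ a nonzero separable Hilbert space. For $E>0$ put $$\mathcal V_E:=\{\eta\in\mathcal D(\sqrt G\otimes I_{\mathcal K}):\|\sqrt G\otimes I_{\mathcal K}\,\eta\|^2\le E\}.$$ If $A\in\mathfrak B^0_G(\mathcal H)$ then the operator $A\otimes I_{\mathcal K}$ (extended to $\mathcal D(\sqrt G\otimes I_{\mathcal K})$) is uniformly continuous on the set $\mathcal V_E$ for any $E>0$. Quantitatively, $$\|A\otimes I_{\mathcal K}(\eta-\theta)\|\le\varepsilon\|A\|^G_{4E/\varepsilon^2}=o(1)\quad\text{as }\varepsilon\to0^+$$ for any vectors $\eta,\theta\in\mathcal V_E$ such that $\|\eta-\theta\|\le\varepsilon$. If $A\in\mathfrak B_G(\mathcal H)\setminus\mathfrak B^0_G(\mathcal H)$ then the operator $A\otimes I_{\mathcal K}$ is not continuous on the set $\mathcal V_E$ for any $E>0$.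
   Context: A linear operator $A$ (values in $\mathcal H$) defined on $\mathcal D(\sqrt G)$ is $\sqrt G$-bounded if $\|A\varphi\|^2\le a^2\|\varphi\|^2+b^2\|\sqrt G\varphi\|^2$ for all $\varphi\in\mathcal D(\sqrt G)$ and some $a,b\ge0$. $\mathfrak B_G(\mathcal H)$ is the space of all such operators; $\mathfrak B^0_G(\mathcal H)$ is the subspace of $\sqrt G$-infinitesimal ones, i.e. those for which the infimum of all $b\ge0$ such that, for some $a\ge0$, $\|A\varphi\|^2\le a^2\|\varphi\|^2+b^2\|\sqrt G\varphi\|^2$ for all $\varphi\in\mathcal D(\sqrt G)$, is $0$; equivalently $\|A\|^G_E=o(\sqrt E)$ as $E\to+\infty$. Here for $E>0$ the operator $E$-norm is $\|A\|^G_E:=\sup\{\|A\varphi\|:\varphi\in\mathcal D(\sqrt G),\ \|\varphi\|=1,\ \|\sqrt G\varphi\|^2\le E\}$. For a $\sqrt G$-bounded $A$, $A\otimes I_{\mathcal K}$ denotes the unique linear $\sqrt G\otimes I_{\mathcal K}$-bounded extension to $\mathcal D(\sqrt G\otimes I_{\mathcal K})$ (domain of the self-adjoint operator $\sqrt G\otimes I_{\mathcal K}$ on $\mathcal H\otimes\mathcal K$) of the operator naturally defined on the linear span of vectors $\varphi\otimes\psi$, $\varphi\in\mathcal D(\sqrt G)$, $\psi\in\mathcal K$. Continuity is with respect to the Hilbert space norms. *)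

(* Defs.v *)
From HB Require Import structures.
From mathcomp Require Import all_boot all_order all_algebra.
From mathcomp Require Import sesquilinear.
From mathcomp Require Import all_classical all_reals all_analysis.
From mathcomp Require Import complex.

Set Implicit Arguments.
Unset Strict Implicit.
Unset Printing Implicit Defensive.

Import Order.TTheory GRing.Theory Num.Theory.
Import numFieldNormedType.Exports.
Local Open Scope classical_set_scope.
Local Open Scope ring_scope.
Local Open Scope complex_scope.

HB.mixin Record isHilbert (R : realType) H & CompleteNormedModule R[i] H := {
  dotp : {dot H for @Num.conj R[i]} ;
  dotp_norm : forall x : H, dotp x x = `|x| ^+ 2
}.

#[short(type="hilbertType")]
HB.structure Definition Hilbert (R : realType) :=
  { H of isHilbert R H & CompleteNormedModule R[i] H }.

(* The norm of a normed module over [R[i]] takes its values in [R[i]]. *)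
Definition hnorm (R : realType) (V : normedModType R[i]) (x : V) : R :=
  complex.Re `|x|.

Definition separable (T : topologicalType) : Prop :=
  exists2 D : set T, countable D & dense D.

Definition span (K : pzRingType) (V : lmodType K) (X : set V) : set V :=
  [set v | exists n (c : 'I_n -> K) (x : 'I_n -> V),
     (forall i, X (x i)) /\ v = \sum_i c i *: x i].

Definition finite_dim (K : pzRingType) (V : lmodType K) : Prop :=
  exists2 X : set V, finite_set X & span X = setT.

(* A linear operator from [V] to [W] whose domain is a subspace of [V]; the
   values of the underlying total function outside [dom] are irrelevant. *)
Record linop (K : pzRingType) (V W : lmodType K) := LinOp {
  dom : set V ;
  opfun :> V -> W ;
  dom0 : dom 0 ;
  dom_lin : forall (c : K) x y, dom x -> dom y -> dom (c *: x + y) ;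
  opfun_lin : forall (c : K) x y, dom x -> dom y ->
    opfun (c *: x + y) = c *: opfun x + opfun y }.

Definition graph (K : pzRingType) (V W : lmodType K) (A : linop V W) :
    set (V * W) :=
  [set p | dom A p.1 /\ p.2 = A p.1].

Section Operators.
Variables (R : realType) (H : hilbertType R).
Implicit Types (A G S : linop H H).

Definition bounded_op A : Prop :=
  exists M : R, forall x, dom A x -> hnorm (A x) <= M * hnorm x.

(* For densely defined [A] this is the graph of the adjoint of [A]. *)
Definition adjoint_graph A : set (H * H) :=
  [set p | forall x, dom A x -> dotp (A x) p.1 = dotp x p.2].

Definition self_adjoint A : Prop :=
  dense (dom A) /\ graph A = adjoint_graph A.

(* The order of [R[i]] makes [0 <= z] include that [z] is real. *)
Definition pos_semidef A : Prop :=
  forall x, dom A x -> 0 <= dotp (A x) x.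

(* [S] is the square root of [G]: the (unique) positive semidefinite
   self-adjoint operator with [S \o S = G], equality of domains included. *)
Definition is_sqrt G S : Prop :=
  [/\ self_adjoint S, pos_semidef S,
      dom G = [set x | dom S x /\ dom S (S x)] &
      forall x, dom G x -> G x = S (S x)].

Definition rel_bound S A (a b : R) : Prop :=
  [/\ 0 <= a, 0 <= b &
      forall x, dom S x ->
        hnorm (A x) ^+ 2 <= a ^+ 2 * hnorm x ^+ 2 + b ^+ 2 * hnorm (S x) ^+ 2].

Definition rel_bounded S : set (linop H H) :=
  [set A | dom A = dom S /\ exists a b, rel_bound S A a b].

Definition rel_infinitesimal S : set (linop H H) :=
  [set A | rel_bounded S A /\ inf [set b | exists a, rel_bound S A a b] = 0].

(* A supremum in [R]: the set is bounded above when [A] is [S]-bounded, and it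
   is nonempty for [E > 0] when the infimum of [hnorm (S x)] over the unit
   vectors of [dom S] is [0]. *)
Definition energy_norm S A (E : R) : R :=
  sup [set hnorm (A x) | x in
        [set x | [/\ dom S x, hnorm x = 1 & hnorm (S x) ^+ 2 <= E]]].

Definition energy_set S (E : R) : set H :=
  [set x | dom S x /\ hnorm (S x) ^+ 2 <= E].

End Operators.

Section Tensor.
Variables (R : realType) (H K T : hilbertType R).
Variable tens : {bilinear H -> K -> T}.

(* Up to a unitary, [T] with [tens] is the Hilbert space tensor product of
   [H] and [K]. *)
Definition is_tensor_product : Prop :=
  (forall x x' y y', dotp (tens x y) (tens x' y') = dotp x x' * dotp y y') /\
  dense (span [set tens x y | x in [set: H] & y in [set: K]]).

(* [SI] is the closure of the operator defined by [S x (x) y] on the algebraic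
   tensor product [dom S (x) K]; for a self-adjoint [S] this is the self-adjoint
   operator [S (x) I]. *)
Definition is_tensor_id (S : linop H H) (SI : linop T T) : Prop :=
  graph SI =
    closure (span [set (tens x y, tens (S x) y) | x in dom S & y in [set: K]]).

(* [AI] is the (unique) [SI]-bounded linear extension to [dom SI] of the operator
   that maps [x (x) y] to [A x (x) y]. *)
Definition is_tensor_id_ext (A : linop H H) (SI AI : linop T T) : Prop :=
  rel_bounded SI AI /\
  forall x y, dom A x -> AI (tens x y) = tens (A x) y.

End Tensor.

(* Main.v *)
Require Import Defs.
From HB Require Import structures.
From mathcomp Require Import all_boot all_order all_algebra.
From mathcomp Require Import sesquilinear.
From mathcomp Require Import all_classical all_reals all_analysis.
From mathcomp Require Import complex ring lra.

(** Write [S] for the square root of [G].  For [x], [y] in [dom S], a unitary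
    change of basis of the span of [x] and [y] preserves the sums of
    [hnorm x ^+ 2], [hnorm (S x) ^+ 2] and [hnorm (A x) ^+ 2] over the pair, and
    can be chosen, as in the Toeplitz-Hausdorff theorem, so that both new
    vectors have the same norm and the same energy.  Keeping the one with the
    larger image under [A], scaled by [Num.sqrt 2], merges [x] and [y] into one
    vector without changing norm and energy and without decreasing
    [hnorm (A x)].  Hence a finite sum of [tens x_i e_i] with orthogonal [e_i]
    behaves like a single vector of [H], and the inequality follows on the
    core of [S (x) I].  The bound there needs norm exactly [eps]: the missing
    norm is supplied by a vector of small energy, which exists since the infimum of
    the spectrum is [0].  The closure gives the general case.

    If [A] is not infinitesimal, there are [x] with
    [hnorm (A x) ^+ 2 > n * hnorm x ^+ 2 + b ^+ 2 * hnorm (S x) ^+ 2] for a fixed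
    [b > 0] and [n] arbitrarily large.  At fixed energy they tend to [0] while
    their images under [A] do not. *)

Set Implicit Arguments.
Unset Strict Implicit.
Unset Printing Implicit Defensive.

Import Order.TTheory GRing.Theory Num.Theory.
Import numFieldNormedType.Exports.
Local Open Scope classical_set_scope.
Local Open Scope ring_scope.

Local Notation Re := complex.Re.

(** Balls over [R[i]] have radii in [R[i]], where positivity includes being real; this trades them
    for real radii. *)
Lemma gt0_complex (R : realType) (e : R[i]) :
  0 < e -> e = (Re e)%:C%C /\ 0 < Re e.
Proof.
move=> e0; have eE : e = (Re e)%:C%C by rewrite RRe_real // gtr0_real.
by split; rewrite // -ltcR -eE.
Qed.

(** * The norm with real values *)

Section Hnorm.
Variables (R : realType) (V : normedModType R[i]).
Implicit Types (x y : V) (c : R[i]).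

Lemma normE x : `|x| = (hnorm x)%:C%C.
Proof. by rewrite /hnorm RRe_real // normr_real. Qed.

Lemma hnorm_ge0 x : 0 <= hnorm x.
Proof. by rewrite -ler0c -normE. Qed.

Lemma hnormZ c x : hnorm (c *: x) = Re `|c| * hnorm x.
Proof. by rewrite {1}/hnorm normrZ normE (normc_def c) /= mul0r subr0. Qed.

Lemma hnormZr (a : R) x : hnorm (a%:C%C *: x) = `|a| * hnorm x.
Proof. by rewrite hnormZ normc_def /= expr0n addr0 sqrtr_sqr. Qed.

Lemma hnorm_opp x : hnorm (- x) = hnorm x.
Proof. by rewrite /hnorm normrN. Qed.

Lemma ler_hnormD x y : hnorm (x + y) <= hnorm x + hnorm y.
Proof. by rewrite -lecR rmorphD /= -!normE ler_normD. Qed.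

Lemma hnorm0 : hnorm (0 : V) = 0.
Proof. by rewrite /hnorm normr0. Qed.

Lemma hnorm_eq0 x : (hnorm x == 0) = (x == 0).
Proof.
rewrite -[RHS]normr_eq0 normE; apply/eqP/eqP => [->//|/(congr1 (@Re R))//].
Qed.

Lemma hnorm_gt0 x : (0 < hnorm x) = (x != 0).
Proof. by rewrite lt_def hnorm_eq0 hnorm_ge0 andbT. Qed.

Lemma hnorm_ball x (e : R) y : ball x e%:C%C y = (hnorm (x - y) < e) :> Prop.
Proof. by rewrite -ball_normE /= normE ltcR. Qed.

End Hnorm.

(** * Inner products and plane rotations *)

Section Dotp.
Variables (R : realType) (H : hilbertType R).
Implicit Types (x y z : H) (a b : R).

Lemma dotpC x y : dotp y x = (dotp x y)^*%C.
Proof. by rewrite hermC expr0 mul1r. Qed.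

Lemma dotpp x : dotp x x = (hnorm x ^+ 2)%:C%C.
Proof. by rewrite dotp_norm normE rmorphXn. Qed.

Lemma dotpZl (c : R[i]) x y : dotp (c *: x) y = c * dotp x y.
Proof. exact: linearZl_LR. Qed.

Lemma dotpZr (c : R[i]) x y : dotp x (c *: y) = c^*%C * dotp x y.
Proof. exact: linearZr_LR. Qed.

Lemma hnorm_comb a b x y : hnorm (a%:C%C *: x + b%:C%C *: y) ^+ 2 =
  a ^+ 2 * hnorm x ^+ 2 + b ^+ 2 * hnorm y ^+ 2 + 2 * a * b * Re (dotp x y).
Proof.
rewrite -[LHS]/(Re (_ ^+ 2)%:C%C) -dotpp linearDl /= !linearDr /=.
rewrite !dotpZl !dotpZr !conjc_real !dotpp (dotpC x y).
by case: (dotp x y) => p q /=; ring.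
Qed.

Lemma hnorm_comb0 a b x y : Re (dotp x y) = 0 ->
  hnorm (a%:C%C *: x + b%:C%C *: y) ^+ 2 =
  a ^+ 2 * hnorm x ^+ 2 + b ^+ 2 * hnorm y ^+ 2.
Proof. by rewrite hnorm_comb => ->; rewrite mulr0 addr0. Qed.

Lemma cauchy_schwarz x y : Re (dotp x y) <= hnorm x * hnorm y.
Proof.
have [->|y0] := eqVneq y 0; first by rewrite linear0r hnorm0 mulr0.
have ny0 : 0 < hnorm y by rewrite hnorm_gt0.
have [->|x0] := eqVneq x 0; first by rewrite linear0l hnorm0 mul0r.
have nx0 : 0 < hnorm x by rewrite hnorm_gt0.
have := sqr_ge0 (hnorm ((hnorm y)%:C%C *: x + (- hnorm x)%:C%C *: y)).
rewrite hnorm_comb => h.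
have {}h : 0 <= 2 * (hnorm x * hnorm y) *
  (hnorm x * hnorm y - Re (dotp x y)) by lra.
by move: h; rewrite pmulr_rge0 ?subr_ge0 // mulr_gt0 // mulr_gt0.
Qed.

(** With [w := dotp x y], the phase ['i * w / |w|] turns [w] into [- 'i * |w|], since [dotp] is
    conjugate-linear in its second argument. *)
Lemma exists_phase x y : exists2 u : R[i], Re `|u| = 1 & Re (dotp x (u *: y)) = 0.
Proof.
have [w0|w0] := eqVneq (dotp x y) 0.
  by exists 1; rewrite ?normr1 // dotpZr w0 mulr0.
exists ('i%C * dotp x y / `|dotp x y|).
  rewrite normrM normrM normrV ?unitfE ?normr_eq0 // normr_id mulfK ?normr_eq0 //.
  by rewrite normc_def /= expr0n expr1n add0r sqrtr1.
rewrite dotpZr normc_def -fmorphV /=.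
case: (dotp x y) => p q /=; set t := (Num.sqrt _)^-1; ring.
Qed.

Lemma hnorm_rotation a b x y : a ^+ 2 + b ^+ 2 = 1 ->
  hnorm (a%:C%C *: x + b%:C%C *: y) ^+ 2 +
  hnorm ((- b)%:C%C *: x + a%:C%C *: y) ^+ 2 = hnorm x ^+ 2 + hnorm y ^+ 2.
Proof.
move=> ab; rewrite !hnorm_comb -[RHS]mul1r -ab; ring.
Qed.

End Dotp.

(** * Linear operators on a domain *)

Section LinopTheory.
Variables (K : pzRingType) (V W : lmodType K) (f : linop V W).

Lemma domD x y : dom f x -> dom f y -> dom f (x + y).
Proof. by move=> fx fy; rewrite -[x]scale1r; apply: dom_lin. Qed.

Lemma domZ c x : dom f x -> dom f (c *: x).
Proof. by move=> fx; rewrite -[_ *: _]addr0; apply: dom_lin => //; exact: dom0. Qed.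

Lemma domB x y : dom f x -> dom f y -> dom f (x - y).
Proof. by move=> fx fy; rewrite -scaleN1r addrC; apply: dom_lin. Qed.

Lemma opfunD x y : dom f x -> dom f y -> f (x + y) = f x + f y.
Proof. by move=> fx fy; rewrite -{1}[x]scale1r opfun_lin // scale1r. Qed.

Lemma opfun0 : f 0 = 0.
Proof.
apply: (addIr (f 0)); rewrite add0r -opfunD ?addr0 //; exact: dom0.
Qed.

Lemma opfunZ c x : dom f x -> f (c *: x) = c *: f x.
Proof.
move=> fx; rewrite -[c *: x]addr0 opfun_lin //; last exact: dom0.
by rewrite opfun0 addr0.
Qed.

Lemma opfunB x y : dom f x -> dom f y -> f (x - y) = f x - f y.
Proof.
by move=> fx fy; rewrite -scaleN1r addrC opfun_lin // scaleN1r addrC.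
Qed.

Lemma dom_sum n (F : 'I_n -> V) :
  (forall i, dom f (F i)) -> dom f (\sum_i F i).
Proof.
by move=> fF; elim/big_ind: _ => // [|x y]; [exact: dom0 | exact: domD].
Qed.

Lemma opfun_sum n (F : 'I_n -> V) :
  (forall i, dom f (F i)) -> f (\sum_i F i) = \sum_i f (F i).
Proof.
elim: n F => [|n IHn] F fF; first by rewrite !big_ord0 opfun0.
by rewrite !big_ord_recr /= opfunD ?IHn //; apply: dom_sum.
Qed.

End LinopTheory.

(** * Merging vectors by rotations *)

(** With [p] the difference of two squared norms and [q] the real part of the inner product, the
    second equation says that the rotated vectors have equal norms. For [k = b / a] it is the
    quadratic [k ^+ 2 = 1 + 2 * t * k] with [t = 2 * q / p], solved by its larger root. *)
Lemma exists_rotation (R : rcfType) (p q : R) :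
  exists a b, a ^+ 2 + b ^+ 2 = 1 /\ (a ^+ 2 - b ^+ 2) * p + 4 * a * b * q = 0.
Proof.
have [->|p0] := eqVneq p 0; first by exists 1, 0; split; ring.
pose t := 2 * q / p; pose k := t + Num.sqrt (t ^+ 2 + 1).
have kE : k ^+ 2 = 1 + 2 * t * k.
  have := @sqr_sqrtr R (t ^+ 2 + 1) (addr_ge0 (sqr_ge0 _) ler01).
  rewrite /k; set r := Num.sqrt _ => h; ring: h.
have k1 : 0 < 1 + k ^+ 2 by rewrite ltr_wpDr ?sqr_ge0.
have s0 : Num.sqrt (1 + k ^+ 2) != 0 by rewrite sqrtr_eq0 -ltNge.
have sE : (Num.sqrt (1 + k ^+ 2))^-1 ^+ 2 = (1 + k ^+ 2)^-1.
  by rewrite exprVn sqr_sqrtr // ltW.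
set c := (Num.sqrt _)^-1 in sE.
exists c, (k * c); split.
  by rewrite exprMn sE -{1}[_^-1]mul1r -mulrDl divff ?gt_eqF.
have -> : (c ^+ 2 - (k * c) ^+ 2) * p + 4 * c * (k * c) * q =
  c ^+ 2 * (p * (1 - k ^+ 2) + 4 * k * q) by ring.
rewrite kE /t; have -> : p * (1 - (1 + 2 * (2 * q / p) * k)) + 4 * k * q = 0.
  by field.
by rewrite mulr0.
Qed.

Section Merge.
Variables (R : realType) (H : hilbertType R) (S A : linop H H).
Hypothesis domAS : dom A = dom S.

Definition same_totals (x y x' y' : H) : Prop :=
  [/\ hnorm x' ^+ 2 + hnorm y' ^+ 2 = hnorm x ^+ 2 + hnorm y ^+ 2,
      hnorm (S x') ^+ 2 + hnorm (S y') ^+ 2 =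
        hnorm (S x) ^+ 2 + hnorm (S y) ^+ 2 &
      hnorm (A x') ^+ 2 + hnorm (A y') ^+ 2 =
        hnorm (A x) ^+ 2 + hnorm (A y) ^+ 2].

Lemma rotate x y (u : R[i]) (a b : R) : dom S x -> dom S y -> Re `|u| = 1 ->
  a ^+ 2 + b ^+ 2 = 1 ->
  let x' := a%:C%C *: x + b%:C%C *: (u *: y) in
  let y' := (- b)%:C%C *: x + a%:C%C *: (u *: y) in
  [/\ dom S x', dom S y' & same_totals x y x' y'].
Proof.
move=> Sx Sy u1 ab x' y'.
have Suy : dom S (u *: y) by exact: domZ.
split; try by rewrite /x' /y'; do ?[apply: domD|apply: domZ].
split; rewrite /x' /y'; first by rewrite hnorm_rotation // (hnormZ u) u1 mul1r.
  by rewrite !opfunD ?opfunZ ?hnorm_rotation ?(hnormZ u) ?u1 ?mul1r //; apply: domZ.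
move: Sx Sy Suy; rewrite -domAS => Ax Ay Auy.
by rewrite !opfunD ?opfunZ ?hnorm_rotation ?(hnormZ u) ?u1 ?mul1r //; apply: domZ.
Qed.

Lemma same_totals_trans x y x' y' x'' y'' :
  same_totals x y x' y' -> same_totals x' y' x'' y'' -> same_totals x y x'' y''.
Proof. by move=> [h1 h2 h3] [g1 g2 g3]; split; congruence. Qed.

Lemma balance_norm x y : dom S x -> dom S y -> exists x' y',
  [/\ dom S x', dom S y', same_totals x y x' y' & hnorm x' = hnorm y'].
Proof.
move=> Sx Sy; have [u u1 xuy] := exists_phase x y.
(* These arguments force [a ^+ 2 = b ^+ 2], a rotation by an odd multiple of 45 degrees. *)
have [a [b [ab abE]]] := exists_rotation (1 : R) 0.
have [Sx' Sy' tot] := rotate Sx Sy u1 ab.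
do 2!eexists; split; [exact: Sx' | exact: Sy' | exact: tot |].
apply/eqP; rewrite -(@eqrXn2 _ 2) ?hnorm_ge0 //; apply/eqP.
have abE2 : a ^+ 2 = b ^+ 2 by lra.
by rewrite !hnorm_comb0 // sqrrN abE2; ring.
Qed.

(** Once the norms agree and the real part of the inner product vanishes, every rotation keeps the
    norms equal, so the angle is free to equalise the energies. *)
Lemma balance_energy x y : dom S x -> dom S y -> exists x' y',
  [/\ dom S x', dom S y', same_totals x y x' y', hnorm x' = hnorm y' &
      hnorm (S x') = hnorm (S y')].
Proof.
move=> Sx0 Sy0; have [x1 [y1 [Sx Sy tot1 n1]]] := balance_norm Sx0 Sy0.
have [u u1 xuy] := exists_phase x1 y1.
have [a [b [ab abE]]] := exists_rotation
  (hnorm (S x1) ^+ 2 - hnorm (S y1) ^+ 2) (Re (dotp (S x1) (u *: S y1))).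
have [Sx' Sy' tot] := rotate Sx Sy u1 ab.
do 2!eexists; split; [exact: Sx' | exact: Sy' | |  |].
- exact: same_totals_trans tot1 tot.
- apply/eqP; rewrite -(@eqrXn2 _ 2) ?hnorm_ge0 //; apply/eqP.
  by rewrite !hnorm_comb0 // (hnormZ u) u1 n1 mul1r; ring.
apply/eqP; rewrite -(@eqrXn2 _ 2) ?hnorm_ge0 //; apply/eqP.
rewrite !opfunD ?opfunZ //; try by do ?apply: domZ.
by rewrite !hnorm_comb (hnormZ u) u1 mul1r; lra.
Qed.

Definition merges n (x : 'I_n -> H) (z : H) : Prop :=
  [/\ dom S z, hnorm z ^+ 2 = \sum_i hnorm (x i) ^+ 2,
      hnorm (S z) ^+ 2 = \sum_i hnorm (S (x i)) ^+ 2 &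
      \sum_i hnorm (A (x i)) ^+ 2 <= hnorm (A z) ^+ 2].

Lemma merge_pair x y : dom S x -> dom S y -> exists z,
  [/\ dom S z, hnorm z ^+ 2 = hnorm x ^+ 2 + hnorm y ^+ 2,
      hnorm (S z) ^+ 2 = hnorm (S x) ^+ 2 + hnorm (S y) ^+ 2 &
      hnorm (A x) ^+ 2 + hnorm (A y) ^+ 2 <= hnorm (A z) ^+ 2].
Proof.
move=> Sx0 Sy0; have [x1 [y1 [Sx Sy [h1 h2 h3] n1 s1]]] := balance_energy Sx0 Sy0.
wlog le_yx : x1 y1 Sx Sy h1 h2 h3 n1 s1 / hnorm (A y1) <= hnorm (A x1).
  move=> hw; have [le|/ltW le] := leP (hnorm (A y1)) (hnorm (A x1)).
    exact: (hw x1 y1).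
  by apply: (hw y1 x1) => //; rewrite addrC.
have s2 : `|Num.sqrt 2 : R| ^+ 2 = 2.
  by rewrite real_normK ?num_real // sqr_sqrtr.
exists ((Num.sqrt 2)%:C%C *: x1); split.
- exact: domZ.
- by rewrite hnormZr exprMn s2 -h1 -n1; ring.
- by rewrite opfunZ // hnormZr exprMn s2 -h2 -s1; ring.
rewrite opfunZ ?domAS // hnormZr exprMn s2 -h3.
have : hnorm (A y1) ^+ 2 <= hnorm (A x1) ^+ 2 by rewrite lerXn2r ?nnegrE ?hnorm_ge0.
lra.
Qed.

Lemma merge_family n (x : 'I_n -> H) : (forall i, dom S (x i)) ->
  exists z, merges x z.
Proof.
elim: n x => [|n IHn] x Sx.
  exists 0; split; rewrite ?big_ord0 ?opfun0 ?hnorm0 ?expr0n ?sqr_ge0 //.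
  exact: dom0.
have [z [Sz nz sz az]] := IHn _ (fun i => Sx (widen_ord (leqnSn n) i)).
have [w [Sw nw sw aw]] := merge_pair Sz (Sx ord_max).
exists w; split; rewrite ?big_ord_recr //= -?nz -?sz //.
exact: le_trans (lerD az (lexx _)) aw.
Qed.

End Merge.

(** * The energy norm *)

Section EnergyNorm.
Variables (R : realType) (H : hilbertType R) (S A : linop H H).

Lemma rel_bound_hnorm (a b : R) x : rel_bound S A a b -> dom S x ->
  hnorm (A x) <= a * hnorm x + b * hnorm (S x).
Proof.
move=> [a0 b0 hA] Sx; have nx := hnorm_ge0 x; have nSx := hnorm_ge0 (S x).
rewrite -ler_sqr ?nnegrE ?hnorm_ge0 ?addr_ge0 ?mulr_ge0 //.
apply: le_trans (hA _ Sx) _; rewrite sqrrD !exprMn.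
have := mulr_ge0 (mulr_ge0 a0 nx) (mulr_ge0 b0 nSx); lra.
Qed.

Lemma energy_norm_ge0 E : 0 <= energy_norm S A E.
Proof.
rewrite /energy_norm; set Y := (X in sup X).
(* A supremum that fails [has_sup] has the default value [0]. *)
have [|/sup_out ->//] := pselect (has_sup Y).
move=> [[r Yr] ubY]; apply: le_trans (ub_le_sup ubY Yr).
by case: Yr => x _ <-; exact: hnorm_ge0.
Qed.

Lemma energy_norm_le (a b E : R) : rel_bound S A a b -> 0 <= E ->
  energy_norm S A E <= Num.sqrt (a ^+ 2 + b ^+ 2 * E).
Proof.
move=> [a0 b0 hA] E0; rewrite /energy_norm; set Y := (X in sup X).
have [Y0|] := pselect (Y !=set0); last first.
  by move=> Y0; rewrite sup_out ?sqrtr_ge0 // => -[].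
apply: ge_sup => // _ [x [Sx nx sx] <-].
rewrite -[leLHS]ger0_norm ?hnorm_ge0 // -sqrtr_sqr ler_wsqrtr //.
by apply: le_trans (hA _ Sx) _; rewrite nx expr1n mulr1 lerD2l ler_wpM2l ?sqr_ge0.
Qed.

Lemma le_energy_norm (a b E : R) x : rel_bound S A a b -> dom S x ->
  hnorm x = 1 -> hnorm (S x) ^+ 2 <= E -> hnorm (A x) <= energy_norm S A E.
Proof.
move=> [a0 b0 hA] Sx nx sx; apply: ub_le_sup; last by exists x.
exists (Num.sqrt (a ^+ 2 + b ^+ 2 * E)) => _ [y [Sy ny sy] <-].
rewrite -[leLHS]ger0_norm ?hnorm_ge0 // -sqrtr_sqr ler_wsqrtr //.
by apply: le_trans (hA _ Sy) _; rewrite ny expr1n mulr1 lerD2l ler_wpM2l ?sqr_ge0.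
Qed.

Hypothesis domAS : dom A = dom S.

(** Homogeneity: [x] scaled by [e^-1] is a unit vector of energy at most [F / e ^+ 2]. *)
Lemma le_scaled_energy_norm (a b e F : R) x : rel_bound S A a b -> dom S x ->
  0 < e -> hnorm x ^+ 2 = e ^+ 2 -> hnorm (S x) ^+ 2 <= F ->
  hnorm (A x) <= e * energy_norm S A (F / e ^+ 2).
Proof.
move=> hA Sx e0 nx sx.
have nxe : hnorm x = e.
  by apply/eqP; rewrite -(@eqrXn2 _ 2) ?hnorm_ge0 ?nx // ltW.
have ie0 : 0 <= e^-1 by rewrite invr_ge0 ltW.
rewrite mulrC -ler_pdivrMr // mulrC.
rewrite -[e^-1]ger0_norm // -hnormZr -opfunZ ?domAS //.
apply: (le_energy_norm hA); first exact: domZ.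
  by rewrite hnormZr nxe ger0_norm // mulVf // gt_eqF.
rewrite opfunZ // hnormZr ger0_norm // exprMn exprVn mulrC.
by rewrite ler_wpM2r ?invr_ge0 ?sqr_ge0.
Qed.

(** By [energy_norm_le] the function is at most the square root of [(a * eps) ^+ 2 + b ^+ 2 * E] for
    every admissible pair: first [b] is taken near the infimum [0], then [eps] small depending on
    [a]. *)
Lemma energy_norm_littleo E : rel_infinitesimal S A -> 0 < E ->
  (fun eps : R => eps * energy_norm S A (E / eps ^+ 2)) @ 0^'+ --> (0 : R).
Proof.
move=> [[_ [a0 [b0 hAB]]] infA] E0; apply/cvgrPdist_le => /= d d0.
set Y := (X in inf X) in infA.
have infY : has_inf Y.
  by split; [exists b0; exists a0 | exists 0 => b [a [_ ? _]]].
(* Then [t * Num.sqrt E = d / 2], so that each of the two summands is at most [(d / 2) ^+ 2]. *)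
pose t := d / (2 * Num.sqrt E).
have sE0 : 0 < Num.sqrt E by rewrite sqrtr_gt0.
have t0 : 0 < t by rewrite divr_gt0 // mulr_gt0.
have [b [a hb]] := inf_adherent t0 infY; rewrite infA add0r => bt.
have [a_ge0 b_ge0 _] := hb.
near=> e; have e0 : 0 < e by [].
rewrite sub0r normrN ger0_norm ?mulr_ge0 ?energy_norm_ge0 ?(ltW e0) //.
apply: le_trans (ler_wpM2l (ltW e0) (energy_norm_le hb _)) _.
  by rewrite divr_ge0 ?sqr_ge0 // ltW.
have -> : d = Num.sqrt (d ^+ 2) by rewrite sqrtr_sqr gtr0_norm.
rewrite -{1}[e]gtr0_norm // -sqrtr_sqr -sqrtrM ?sqr_ge0 // ler_wsqrtr //.
have -> : e ^+ 2 * (a ^+ 2 + b ^+ 2 * (E / e ^+ 2)) = (a * e) ^+ 2 + b ^+ 2 * E.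
  by field; rewrite gt_eqF.
have ae : a * e <= d / 2.
  have : e <= d / (2 * (a + 1)).
    by near: e; apply: nbhs_right_le; rewrite divr_gt0 // mulr_gt0 // ltr_wpDl.
  have a1 : 0 < a + 1 by rewrite ltr_wpDl.
  rewrite ler_pdivlMr ?mulr_gt0 // => h; nra.
have ae2 : (a * e) ^+ 2 <= (d / 2) ^+ 2.
  by rewrite lerXn2r ?nnegrE ?mulr_ge0 ?divr_ge0 // ltW.
have b2 : b ^+ 2 <= t ^+ 2 by rewrite lerXn2r ?nnegrE // ltW.
have tE : t ^+ 2 * E = (d / 2) ^+ 2.
  rewrite /t -{2}(sqr_sqrtr (ltW E0)); field; exact: lt0r_neq0.
have := ler_wpM2r (ltW E0) b2; rewrite tE => b2E.
have := sqr_ge0 d; nra.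
Unshelve. all: by end_near.
Qed.

End EnergyNorm.

(** * Unit vectors of small energy *)

Section Sqrt.
Variables (R : realType) (H : hilbertType R) (G S : linop H H).
Hypotheses (G_unbounded : ~ bounded_op G) (sqrtG : is_sqrt G S).
Hypothesis G_inf :
  inf [set hnorm (G x) | x in [set x | dom G x /\ hnorm x = 1]] = 0.

(** By self-adjointness [hnorm (S x) ^+ 2] is the inner product of [G x] and [x], hence at most
    [hnorm (G x)] for a unit vector, and this has infimum [0]. *)
Lemma exists_small_energy (d : R) : 0 < d ->
  exists x, [/\ dom S x, hnorm x = 1 & hnorm (S x) ^+ 2 <= d].
Proof.
move=> d0; have := G_inf; set Y := (X in inf X) => infY0.
have infY : has_inf Y.
  split; last by exists 0 => _ [x _ <-]; exact: hnorm_ge0.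
  (* The infimum of an empty set is [0] by default, so [G_inf] alone yields no unit vector; without
     one in its domain, [G] would be bounded by [0]. *)
  apply: contrapT => Y0; apply: G_unbounded; exists 0 => x Gx; rewrite mul0r.
  have [->|x0] := eqVneq x 0; first by rewrite opfun0 hnorm0.
  exfalso; apply: Y0.
  exists (hnorm (G ((hnorm x)^-1%:C%C *: x))).
  exists ((hnorm x)^-1%:C%C *: x) => //; split; first exact: domZ.
  by rewrite hnormZr ger0_norm ?invr_ge0 ?hnorm_ge0 // mulVf // hnorm_eq0.
have [_ [x [Gx nx] <-]] := inf_adherent d0 infY.
rewrite infY0 add0r => Gxd.
have [[_ S_sa] _ domG GE] := sqrtG.
have [Sx SSx] : dom S x /\ dom S (S x) by move: Gx; rewrite domG.
exists x; split=> //.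
have /(_ (S x) SSx) /= : adjoint_graph S (x, S x) by rewrite -S_sa.
rewrite -GE // dotpp => /(congr1 (@Re R)) /= <-.
by apply: le_trans (cauchy_schwarz _ _) _; rewrite nx mulr1 ltW.
Qed.

End Sqrt.

(** * Orthogonal families *)

Section OrthogonalSums.
Variables (R : realType) (H : hilbertType R).

Definition pairwise_orth n (e : 'I_n -> H) : Prop :=
  forall i j, i != j -> dotp (e i) (e j) = 0.

Lemma hnorm_sum_orth n (v : 'I_n -> H) : pairwise_orth v ->
  hnorm (\sum_i v i) ^+ 2 = \sum_i hnorm (v i) ^+ 2.
Proof.
move=> ov; apply: complexI; rewrite -dotpp rmorph_sum linear_sumlz /=.
apply: eq_bigr => i _; rewrite linear_sumr /= (bigD1 i) //= big1 ?addr0 ?dotpp //.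
by move=> j; rewrite eq_sym; exact: ov.
Qed.

Lemma gram_schmidt_step n (e : 'I_n -> H) y : pairwise_orth e ->
  exists c : 'I_n -> R[i],
    forall j, dotp (y - \sum_i c i *: e i) (e j) = 0.
Proof.
(* For [e i = 0] division by zero makes the coefficient [0], as required. *)
move=> oe; exists (fun i => dotp y (e i) / dotp (e i) (e i)) => j.
rewrite linearBl /= linear_sumlz /= (bigD1 j) //= big1 ?addr0.
  rewrite dotpZl; have [->|ej0] := eqVneq (e j) 0.
    by rewrite !linear0r subrr.
  by rewrite divfK ?subrr // gt_eqF // neq0_dnorm_gt0.
by move=> i ij; rewrite dotpZl (oe i j) ?mulr0.
Qed.

End OrthogonalSums.

(** * Operators on the tensor product *)

Definition ord_cons (X : Type) n (x : X) (f : 'I_n -> X) (i : 'I_n.+1) : X :=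
  oapp f x (unlift ord0 i).

Section Tensor.
Variables (R : realType) (H K T : hilbertType R).
Variable tens : {bilinear H -> K -> T}.
Hypothesis T_tensor : is_tensor_product tens.

Lemma hnorm_tens x y : hnorm (tens x y) = hnorm x * hnorm y.
Proof.
apply/eqP; rewrite -(@eqrXn2 _ 2) ?mulr_ge0 ?hnorm_ge0 //; apply/eqP.
by apply: complexI; rewrite -dotpp T_tensor.1 !dotpp exprMn -rmorphM.
Qed.

(** The [e i] are orthogonal but not normalised and may vanish, so a linear dependence needs no
    separate case. *)
Definition orth_tensor (D : set H) (eta : T) : Prop :=
  exists n (x : 'I_n -> H) (e : 'I_n -> K),
    [/\ forall i, D (x i), pairwise_orth e & eta = \sum_i tens (x i) (e i)].

Lemma hnorm_orth_tensor n (x : 'I_n -> H) (e : 'I_n -> K) : pairwise_orth e ->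
  hnorm (\sum_i tens (x i) (e i)) ^+ 2 =
  \sum_i hnorm ((hnorm (e i))%:C%C *: x i) ^+ 2.
Proof.
move=> oe; rewrite hnorm_sum_orth; last first.
  by move=> i j ij; rewrite T_tensor.1 oe ?mulr0.
apply: eq_bigr => i _.
by rewrite hnorm_tens hnormZr (ger0_norm (hnorm_ge0 _)) mulrC.
Qed.

(** Only the part [y'] of [y] orthogonal to all [e i] needs a new term; the rest, a combination of
    the [e i], is absorbed by adding [c i *: x] to [z i]. *)
Lemma orth_tensor_add (S : linop H H) eta x y :
  orth_tensor (dom S) eta -> dom S x -> orth_tensor (dom S) (eta + tens x y).
Proof.
move=> [n [z [e [Sz oe ->]]]] Sx.
have [c hc] := gram_schmidt_step y oe; set y' := y - _ in hc.
exists n.+1, (ord_cons x (fun i => z i + c i *: x)), (ord_cons y' e); split.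
- move=> i; rewrite /ord_cons; case: unliftP => [j _|_] //=.
  by apply: domD => //; exact: domZ.
- move=> i j; rewrite /ord_cons.
  case: unliftP => [i' ->|->]; case: unliftP => [j' ->|->] /=; rewrite ?eqxx //.
  + by move=> ij; apply: oe; apply: contra_neq ij => ->.
  + by move=> _; rewrite dotpC hc conjc0.
rewrite big_ord_recl /ord_cons unlift_none /=.
rewrite [in RHS](eq_bigr (fun i => tens (z i) (e i) + tens x (c i *: e i))); last first.
  by move=> i _; rewrite liftK /= linearDl /= linearZl_LR /= -linearZr_LR.
rewrite big_split /= -linear_sumr /= addrCA -linearDr /=.
by rewrite /y' subrK.
Qed.

Variables (S A : linop H H) (SI AI : linop T T).
Hypotheses (SI_def : is_tensor_id tens S SI) (AI_def : is_tensor_id_ext tens A SI AI).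
Hypothesis domAS : dom A = dom S.

(** The graph of [SI] is the closure of a span of elementary pairs, and [orth_tensor_add] brings an
    element of the span into orthogonal form one term at a time. *)
Lemma tensor_id_dense eta (d : R) : dom SI eta -> 0 < d -> exists eta',
  [/\ orth_tensor (dom S) eta', dom SI eta',
      hnorm (eta - eta') < d & hnorm (SI eta - SI eta') < d].
Proof.
move=> SIeta d0.
have : graph SI (eta, SI eta) by [].
rewrite [graph SI]SI_def => /(_ (ball eta d%:C%C `*` ball (SI eta) d%:C%C)) [].
  exists (ball eta d%:C%C, ball (SI eta) d%:C%C) => //.
  by split; apply: nbhsx_ballx; rewrite ltcR.
move=> p [pspan [/= b1 b2]].
have [SIp p2E] : graph SI p by rewrite [graph SI]SI_def; exact: subset_closure.
exists p.1; split=> //; last 2 first.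
- by rewrite -hnorm_ball.
- by rewrite -hnorm_ball -p2E.
move: pspan {b1 b2 SIp p2E} => [n [c [q [hq ->]]]].
elim: n c q hq => [|n IHn] c q hq.
  rewrite big_ord0; exists 0%N, (fun=> 0), (fun=> 0).
  by split; rewrite ?big_ord0 // => -[].
rewrite big_ord_recr /=.
have [x Sx [y _ <-]] := hq ord_max.
rewrite -linearZl_LR /=; apply: orth_tensor_add; last exact: domZ.
by apply: (IHn (fun i => c (widen_ord _ i)) (fun i => q (widen_ord _ i))).
Qed.

Lemma tensor_idE x y : dom S x ->
  dom SI (tens x y) /\ SI (tens x y) = tens (S x) y.
Proof.
move=> Sx.
have : graph SI (tens x y, tens (S x) y).
  rewrite [graph SI]SI_def; apply: subset_closure.
  exists 1%N, (fun=> 1), (fun=> (tens x y, tens (S x) y)); split.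
    by move=> _; exists x => //; exists y.
  by rewrite big_ord1 scale1r.
by move=> [].
Qed.

(** For the [x i] scaled by [hnorm (e i)], the three sums in [merges] are the squared norms of
    [eta], [SI eta] and [AI eta]. *)
Lemma merge_orth_tensor eta : orth_tensor (dom S) eta -> exists z,
  [/\ dom S z, hnorm z ^+ 2 = hnorm eta ^+ 2,
      hnorm (S z) ^+ 2 = hnorm (SI eta) ^+ 2 &
      hnorm (AI eta) ^+ 2 <= hnorm (A z) ^+ 2].
Proof.
move=> [n [x [e [Sx oe ->]]]].
have Sex i : dom S ((hnorm (e i))%:C%C *: x i) by exact: domZ.
have [z [Sz nz sz az]] := merge_family domAS Sex.
have [[domAI _] AIE] := AI_def.
have SIx i : dom SI (tens (x i) (e i)) by have [] := tensor_idE (e i) (Sx i).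
exists z; split=> //.
- by rewrite nz hnorm_orth_tensor.
- rewrite sz opfun_sum //.
  under [in RHS]eq_bigr do rewrite (tensor_idE _ (Sx _)).2.
  rewrite (hnorm_orth_tensor _ oe).
  by under eq_bigr do rewrite opfunZ //.
rewrite opfun_sum; last by move=> i; rewrite domAI.
apply: le_trans az.
under eq_bigr do rewrite AIE ?domAS //.
rewrite (hnorm_orth_tensor _ oe).
by under [leRHS]eq_bigr do rewrite opfunZ ?domAS //.
Qed.

Lemma orth_tensor_bound (a b e F : R) eta : rel_bound S A a b ->
  (forall d : R, 0 < d ->
     exists x, [/\ dom S x, hnorm x = 1 & hnorm (S x) ^+ 2 <= d]) ->
  orth_tensor (dom S) eta -> 0 < e -> hnorm eta < e -> hnorm (SI eta) ^+ 2 < F ->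
  hnorm (AI eta) <= e * energy_norm S A (F / e ^+ 2).
Proof.
move=> hA small oeta e0 neta seta.
have [z [Sz nz sz az]] := merge_orth_tensor oeta.
(* The squared norm missing up to [e ^+ 2]. A unit vector [chi] scaled by [Num.sqrt r] supplies it,
   with energy at most the slack [F - hnorm (SI eta) ^+ 2]. *)
pose r := e ^+ 2 - hnorm eta ^+ 2.
have r0 : 0 < r by rewrite subr_gt0 ltr_sqr ?nnegrE ?hnorm_ge0 // ltW.
have d0 : 0 < (F - hnorm (SI eta) ^+ 2) / r by rewrite divr_gt0 // subr_gt0.
have [chi [Schi nchi schi]] := small _ d0.
have Srchi : dom S ((Num.sqrt r)%:C%C *: chi) by exact: domZ.
have [w [Sw nw sw aw]] := merge_pair domAS Sz Srchi.
have sr2 : `|Num.sqrt r| ^+ 2 = r.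
  by rewrite ger0_norm ?sqrtr_ge0 // sqr_sqrtr // ltW.
apply: (@le_trans _ _ (hnorm (A w))).
  rewrite -ler_sqr ?nnegrE ?hnorm_ge0 //; apply: le_trans az _.
  by apply: le_trans aw; rewrite lerDl sqr_ge0.
apply: (le_scaled_energy_norm domAS hA Sw e0).
  by rewrite nw nz hnormZr nchi mulr1 sr2 /r addrC subrK.
rewrite sw sz opfunZ // hnormZr exprMn sr2 addrC -lerBrDr mulrC.
by rewrite -ler_pdivlMr.
Qed.

(** Strict constraints survive a small perturbation in the graph norm of [SI], so [eta] can be
    replaced by a nearby orthogonal tensor; the relative bound of [AI] controls the error. *)
Lemma tensor_energy_bound (a b e F : R) eta : rel_bound S A a b ->
  (forall d : R, 0 < d ->
     exists x, [/\ dom S x, hnorm x = 1 & hnorm (S x) ^+ 2 <= d]) ->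
  dom SI eta -> 0 < e -> 0 < F -> hnorm eta <= e -> hnorm (SI eta) ^+ 2 <= F ->
  hnorm (AI eta) <= e * energy_norm S A (F / e ^+ 2).
Proof.
move=> hA small SIeta e0 F0 neta seta.
wlog [{}neta {}seta] : eta SIeta neta seta /
    hnorm eta < e /\ hnorm (SI eta) ^+ 2 < F.
  move=> hw; set M := e * _.
  have M0 : 0 <= M by rewrite mulr_ge0 ?energy_norm_ge0 // ltW.
  rewrite leNgt; apply/negP => MN; set N := hnorm (AI eta) in MN.
  have N0 : 0 < N by exact: le_lt_trans MN.
  (* Then [t * N] is the midpoint of [M] and [N], so a bound by [M] on the scaled vector is
     contradictory. *)
  pose t := (M + N) / (2 * N).
  have t0 : 0 < t by rewrite divr_gt0 ?mulr_gt0 // ltr_wpDl.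
  have t1 : t < 1 by rewrite ltr_pdivrMr ?mulr_gt0 // mul1r; lra.
  have tN : M < t * N.
    have -> : t * N = (M + N) / 2 by rewrite /t; field; rewrite gt_eqF.
    lra.
  have [domAI _] := AI_def.1.
  (* Shrinking [eta] makes both constraints strict. *)
  have := hw (t%:C%C *: eta).
  rewrite !opfunZ ?domAI // !hnormZr gtr0_norm // -/N -/M => h.
  have tne : t * hnorm eta < e.
    apply: le_lt_trans (ler_wpM2l (ltW t0) neta) _.
    by rewrite gtr_pMl.
  have tse : (t * hnorm (SI eta)) ^+ 2 < F.
    rewrite exprMn; apply: le_lt_trans (ler_wpM2l (sqr_ge0 _) seta) _.
    by rewrite gtr_pMl // expr_lt1 // ltW.
  suff : t * N <= M by rewrite leNgt tN.
  by apply: h => //; [exact: domZ | exact: ltW | exact: ltW].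
have [[domAI [a' [b' hAI]]] _] := AI_def; have [a'0 b'0 _] := hAI.
apply/ler_addgt0Pr => d d0.
have ab0 : 0 < a' + b' + 1 by rewrite ltr_wpDl // addr_ge0.
have sF : hnorm (SI eta) < Num.sqrt F.
  by rewrite -ltr_sqr ?nnegrE ?hnorm_ge0 ?sqrtr_ge0 // sqr_sqrtr // ltW.
(* The first two terms keep both constraints strict for [eta']; the third keeps the error under [AI]
   at most [d]. *)
pose d' := Num.min (Num.min (e - hnorm eta) (Num.sqrt F - hnorm (SI eta)))
  (d / (a' + b' + 1)).
have d'0 : 0 < d' by rewrite !lt_min !subr_gt0 neta sF divr_gt0.
have [eta' [oeta' SIeta' n1 n2]] := tensor_id_dense SIeta d'0.
have d'1 : d' <= e - hnorm eta by rewrite !ge_min lexx.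
have d'2 : d' <= Num.sqrt F - hnorm (SI eta) by rewrite !ge_min lexx !orbT.
have d'3 : (a' + b' + 1) * d' <= d.
  by rewrite mulrC -ler_pdivlMr // !ge_min lexx !orbT.
have neta' : hnorm eta' < e.
  have := ler_hnormD eta (eta' - eta).
  by rewrite addrC subrK -opprB hnorm_opp; lra.
have seta' : hnorm (SI eta') ^+ 2 < F.
  rewrite -[F]sqr_sqrtr ?ltW // ltr_sqr ?nnegrE ?hnorm_ge0 ?sqrtr_ge0 //.
  have := ler_hnormD (SI eta) (SI eta' - SI eta).
  by rewrite addrC subrK -opprB hnorm_opp; lra.
have := orth_tensor_bound hA small oeta' e0 neta' seta'.
have := rel_bound_hnorm hAI (domB SIeta SIeta').
rewrite !opfunB ?domAI // => h1 h2.
have := ler_hnormD (AI eta') (AI eta - AI eta').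
rewrite addrC subrK => /le_trans; apply; apply: lerD => //.
apply: le_trans h1 _; apply: le_trans d'3.
have := ler_wpM2l a'0 (ltW n1); have := ler_wpM2l b'0 (ltW n2); lra.
Qed.

End Tensor.

(** * Continuity and discontinuity on energy sets *)

(** By the triangle inequality the image of the difference has norm at most [2 * Num.sqrt E], whence
    the constant [4]. *)
Lemma energy_setB (R : realType) (H : hilbertType R) (S : linop H H) (E : R) x y :
  0 < E -> energy_set S E x -> energy_set S E y ->
  dom S (x - y) /\ hnorm (S (x - y)) ^+ 2 <= 4 * E.
Proof.
move=> E0 [Sx sx] [Sy sy]; split; first exact: domB.
have le z : hnorm (S z) ^+ 2 <= E -> hnorm (S z) <= Num.sqrt E.
  move=> h; rewrite -ler_sqr ?nnegrE ?hnorm_ge0 ?sqrtr_ge0 //.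
  by rewrite sqr_sqrtr // ltW.
have -> : 4 * E = (2 * Num.sqrt E) ^+ 2.
  by rewrite exprMn sqr_sqrtr ?(ltW E0) //; ring.
rewrite ler_sqr ?nnegrE ?hnorm_ge0 ?mulr_ge0 ?sqrtr_ge0 // opfunB //.
have := ler_hnormD (S x) (- S y); rewrite hnorm_opp.
have := le _ sx; have := le _ sy; lra.
Qed.

(** Half the infimum is admissible with no first coefficient, so the bound with [a1 + k] fails at
    some [x]. Set against the valid bound with [a1] and [b1], this makes [x] short relative to its
    energy, which scaling then fixes at [E]. *)
Lemma rel_boundedN_infinitesimal (R : realType) (H : hilbertType R)
    (S A : linop H H) :
  dom A = dom S -> rel_bounded S A -> ~ rel_infinitesimal S A ->
  exists2 b : R, 0 < b & forall d E : R, 0 < d -> 0 < E -> exists x,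
    [/\ dom S x, hnorm x < d, hnorm (S x) ^+ 2 = E &
        b ^+ 2 * E < hnorm (A x) ^+ 2].
Proof.
move=> domAS bA infA.
have [_ [a1 [b1 [a1_ge0 b1_ge0 hA]]]] := bA.
pose Y := [set b | exists a, rel_bound S A a b].
have lbY : lbound Y 0 by move=> b [a []].
have infY : 0 < inf Y.
  rewrite lt_def lb_le_inf ?andbT //; last by exists b1, a1.
  by apply/eqP => infY; apply: infA.
exists (inf Y / 2); first by rewrite divr_gt0.
move=> d E d0 E0; set b := inf Y / 2.
have b0 : 0 < b by rewrite divr_gt0.
have bY : b < inf Y by rewrite /b; lra.
clearbody b.
(* [k] is chosen so that [k * hnorm x < b1 * hnorm (S x)] reads
   [hnorm x < d] at energy [E]. *)
pose k := b1 * Num.sqrt E / d.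
have k0 : 0 <= k by rewrite divr_ge0 ?mulr_ge0 ?sqrtr_ge0 // ltW.
have [x Sx Ax] : exists2 x, dom S x &
    (a1 + k) ^+ 2 * hnorm x ^+ 2 + b ^+ 2 * hnorm (S x) ^+ 2 < hnorm (A x) ^+ 2.
  apply: contrapT => nex.
  suff : inf Y <= b by rewrite leNgt bY.
  apply: ge_inf; first by exists 0.
  exists (a1 + k); split; rewrite ?addr_ge0 // ?ltW // => x Sx.
  by rewrite leNgt; apply/negP => Ax; apply: nex; exists x.
have {}hA := hA _ Sx.
have sx0 : 0 < hnorm (S x).
  rewrite lt_def hnorm_ge0 andbT; apply/eqP => sx0.
  move: Ax hA; rewrite sx0 expr0n !mulr0 !addr0.
  by have := mulr_ge0 a1_ge0 k0; have := sqr_ge0 (hnorm x); have := sqr_ge0 k; nra.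
pose t := Num.sqrt E / hnorm (S x).
have t0 : 0 < t by rewrite divr_gt0 ?sqrtr_gt0.
have tS : t ^+ 2 * hnorm (S x) ^+ 2 = E.
  by rewrite -exprMn divfK ?gt_eqF // sqr_sqrtr // ltW.
have kx : k ^+ 2 * hnorm x ^+ 2 < b1 ^+ 2 * hnorm (S x) ^+ 2.
  have h1 := mulr_ge0 (mulr_ge0 a1_ge0 k0) (sqr_ge0 (hnorm x)).
  have h2 : 0 < b ^+ 2 * hnorm (S x) ^+ 2 by rewrite mulr_gt0 ?exprn_gt0.
  lra.
exists (t%:C%C *: x); split.
- exact: domZ.
- have tx0 : 0 <= t * hnorm x := mulr_ge0 (ltW t0) (hnorm_ge0 x).
  rewrite hnormZr gtr0_norm // -ltr_sqr ?nnegrE ?(ltW d0) //.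
  have b1_gt0 : 0 < b1.
    rewrite lt_def b1_ge0 andbT; apply/eqP => b1E; move: kx.
    rewrite b1E expr0n mul0r ltNge => /negP; apply.
    by rewrite mulr_ge0 ?sqr_ge0.
  have -> : (t * hnorm x) ^+ 2 =
      (k ^+ 2 * hnorm x ^+ 2) * (d ^+ 2 / (b1 ^+ 2 * hnorm (S x) ^+ 2)).
    by rewrite /t /k; field; rewrite !gt_eqF.
  rewrite mulrA ltr_pdivrMr ?mulr_gt0 ?exprn_gt0 // mulrC ltr_pM2l ?exprn_gt0 //. 
- by rewrite opfunZ // hnormZr gtr0_norm // exprMn.
rewrite opfunZ ?domAS // hnormZr gtr0_norm // exprMn -tS (mulrCA (b ^+ 2)).
rewrite ltr_pM2l ?exprn_gt0 //; apply: le_lt_trans Ax.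
by rewrite lerDr mulr_ge0 ?sqr_ge0.
Qed.

Theorem proposition7 (R : realType) (H K T : hilbertType R)
  (tens : {bilinear H -> K -> T})
  (G sqrtG A : linop H H) (sqrtGI AI : linop T T)
  (H_separable : separable H)
  (H_infinite : ~ finite_dim H)
  (K_separable : separable K)
  (K_nonzero : exists y : K, y != 0)
  (T_tensor : is_tensor_product tens)
  (G_self_adjoint : self_adjoint G)
  (G_psd : pos_semidef G)
  (G_unbounded : ~ bounded_op G)
  (G_inf : inf [set hnorm (G x) | x in [set x | dom G x /\ hnorm x = 1]] = 0)
  (sqrtG_def : is_sqrt G sqrtG)
  (sqrtGI_def : is_tensor_id tens sqrtG sqrtGI)
  (AI_def : is_tensor_id_ext tens A sqrtGI AI) :
  (rel_infinitesimal sqrtG A -> forall E : R, 0 < E ->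
     [/\ unif_continuous (AI : subspace (energy_set sqrtGI E) -> T),
         (forall (eps : R) (eta theta : T), 0 < eps ->
            energy_set sqrtGI E eta -> energy_set sqrtGI E theta ->
            hnorm (eta - theta) <= eps ->
            hnorm (AI (eta - theta)) <=
              eps * energy_norm sqrtG A (4 * E / eps ^+ 2)) &
         (fun eps : R => eps * energy_norm sqrtG A (4 * E / eps ^+ 2))
           @ 0^'+ --> (0 : R)])
  /\
  ((rel_bounded sqrtG `\` rel_infinitesimal sqrtG) A ->
     forall E : R, 0 < E ->
       ~ {within energy_set sqrtGI E, continuous AI}).
Proof.
have [[domAI _] AIE] := AI_def.
have small := exists_small_energy G_unbounded sqrtG_def G_inf.
split=> [infA E E0 | [bA infA] E E0 cAI].
  have [[domAS [a [b hA]]] _] := infA.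
  have bound (eps : R) (eta theta : T) : 0 < eps ->
      energy_set sqrtGI E eta -> energy_set sqrtGI E theta ->
      hnorm (eta - theta) <= eps ->
      hnorm (AI (eta - theta)) <= eps * energy_norm sqrtG A (4 * E / eps ^+ 2).
    move=> e0 Eeta Etheta ne.
    have [SIB sB] := energy_setB E0 Eeta Etheta.
    apply: (tensor_energy_bound T_tensor sqrtGI_def AI_def domAS hA) => //.
    by rewrite mulr_gt0.
  have E4 : 0 < 4 * E by rewrite mulr_gt0.
  have lim := energy_norm_littleo infA E4.
  split=> //; apply/unif_continuousP => ec /gt0_complex [ecE e0].
  rewrite ecE {ecE}; set e := Re ec in e0 *.
  (* Such a [d] serves as the radius for [e] in uniform continuity; it exists because the bound
     tends to [0]. *)
  have [d [d0 de]] : exists d : R, 0 < d /\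
      d * energy_norm sqrtG A (4 * E / d ^+ 2) < e.
    have /cvgrPdist_lt /(_ _ e0) near_e := lim.
    apply: (@filter_ex _ (0 : R)^'+); near=> d; split=> //.
    apply: le_lt_trans (ler_norm _) _; rewrite -normrN -sub0r; near: d.
    exact: near_e.
  exists d%:C%C; first by rewrite ltcR.
  move=> [eta theta] /=; rewrite ball_subspace_ball /subspace_ball.
  (* For [eta] outside the energy set, its ball in the subspace uniformity is the singleton of
     [eta]. *)
  case: ifPn => [/set_mem Eeta [Etheta] | _ /= ->]; last first.
    by apply: ballxx; rewrite ltcR.
  rewrite !hnorm_ball => nd.
  have [SIeta _] := Eeta; have [SItheta _] := Etheta.
  rewrite -opfunB ?domAI //.
  exact: le_lt_trans (bound _ _ _ d0 Eeta Etheta (ltW nd)) de.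
have domAS := bA.1.
have [b b0 hb] := rel_boundedN_infinitesimal domAS bA infA.
have [y y0] := K_nonzero.
have ny0 : 0 < hnorm y by rewrite hnorm_gt0.
(* Continuity is refuted at [0], with [b * Num.sqrt E] as the gap. *)
have E_0 : energy_set sqrtGI E 0.
  by split; [exact: dom0 | rewrite opfun0 hnorm0 expr0n ltW].
have e0 : 0 < b * Num.sqrt E by rewrite mulr_gt0 ?sqrtr_gt0.
have e0C : 0 < (b * Num.sqrt E)%:C%C by rewrite ltcR.
have /cvg_ballP /(_ _ e0C) := (subspace_continuousP _ _).1 cAI 0 E_0.
rewrite /= => /nbhs_ballP [dc /= /gt0_complex [dcE d0]].
rewrite dcE {dcE}; set d := Re dc in d0 * => hd.
(* Dividing by the norm of [y] compensates for it in [tens x y], which gets norm below [d] and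
   energy exactly [E]. *)
have dy0 : 0 < d / hnorm y by rewrite divr_gt0.
have Ey0 : 0 < E / hnorm y ^+ 2 by rewrite divr_gt0 ?exprn_gt0.
have [x [Sx nx sx Ax]] := hb _ _ dy0 Ey0.
have [SIxy SIxyE] := tensor_idE sqrtGI_def y Sx.
have : hnorm (AI (tens x y)) < b * Num.sqrt E.
  have := hd (tens x y); rewrite !hnorm_ball /from_subspace (opfun0 AI) !sub0r !hnorm_opp.
  rewrite (hnorm_tens T_tensor) -ltr_pdivlMr //; apply=> //.
  split=> //; rewrite SIxyE (hnorm_tens T_tensor) exprMn sx divfK //.
  by rewrite expf_neq0 // gt_eqF.
rewrite -ltr_sqr ?nnegrE ?hnorm_ge0 ?(ltW e0) // AIE ?domAS //.
rewrite (hnorm_tens T_tensor) !exprMn sqr_sqrtr ?(ltW E0) //.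
rewrite -ltr_pdivlMr ?exprn_gt0 // -mulrA => /(lt_trans Ax).
by rewrite ltxx.
Unshelve. all: by end_near.
Qed.
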